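(* There exist universal constants $0<c_1\le c_2$ and $C>0$ such that the following holds. Let $0<\mu_x\le L_x$, $0<\mu_y\le L_y$, $L_{xy}\ge 0$, and let $f\in\mathcal F(\mu_x,\mu_y,L_x,L_y,L_{xy})$. Then there exists a pair of step sizes $\alpha,\beta>0$ with $\alpha\mu_x=\beta\mu_y\in\left[\frac{c_1}{\kappa_x+\kappa_y+\kappa_{xy}^2},\frac{c_2}{\kappa_x+\kappa_y+\kappa_{xy}^2}\right]$ for which Sim-GDA satisfies, from every initialization and for all $k\ge0$, $\Psi^{\mathrm{Sim}}_{k+1}\le r\Psi^{\mathrm{Sim}}_k$ with $r=\left(\frac{\xi^2-1}{\xi^2+1}\right)^2$, $\xi=\kappa_{xy}+\sqrt{\max\{\kappa_x,\kappa_y\}+\kappa_{xy}^2}$, and for these step sizes, for every initialization $(x_0,y_0)$ and every $\epsilon>0$, one has $\|z_K-z_\star\|^2\le\epsilon$ for every integer $K\ge0$ with $$K\ge C\,(\kappa_x+\kappa_y+\kappa_{xy}^2)\cdot\log\frac{\Psi^{\mathrm{Sim}}_0}{A^{\mathrm{Sim}}\epsilon},\qquad A^{\mathrm{Sim}}=\min\left\{\frac1\alpha,\frac1\beta\right\}.$$ (That is, Sim-GDA converges linearly with iteration complexity $\mathcal O\big((\kappa_x+\kappa_y+\kappa_{xy}^2)\log\frac{\Psi^{\mathrm{Sim}}_0}{A^{\mathrm{Sim}}\epsilon}\big)$.)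
   Context: Function class. For $0<\mu_x\le L_x$, $0<\mu_y\le L_y$, $L_{xy}\ge0$, $\mathcal F(\mu_x,\mu_y,L_x,L_y,L_{xy})$ is the set of all twice-differentiable $f:\mathbb R^{d_x}\times\mathbb R^{d_y}\to\mathbb R$ (any $d_x,d_y$) such that: (i) $f(\cdot,y)$ is $\mu_x$-strongly convex for every $y$ and $f(x,\cdot)$ is $\mu_y$-strongly concave for every $x$ ($g$ is $\mu$-strongly convex if $g(z')\ge g(z)+\langle\nabla g(z),z'-z\rangle+\frac\mu2\|z'-z\|^2$ for all $z,z'$; $g$ is $\mu$-strongly concave if $-g$ is $\mu$-strongly convex); (ii) for all $x,x',y,y'$: $\|\nabla_xf(x',y)-\nabla_xf(x,y)\|\le L_x\|x'-x\|$, $\|\nabla_yf(x,y')-\nabla_yf(x,y)\|\le L_y\|y'-y\|$, $\|\nabla_xf(x,y')-\nabla_xf(x,y)\|\le L_{xy}\|y'-y\|$, $\|\nabla_yf(x',y)-\nabla_yf(x,y)\|\le L_{xy}\|x'-x\|$. Norms are Euclidean. Every such $f$ has a unique Nash equilibrium $z_\star=(x_\star,y_\star)$, i.e. a point with $f(x_\star,y)\le f(x_\star,y_\star)\le f(x,y_\star)$ for all $x,y$. Condition numbers: $\kappa_x=L_x/\mu_x$, $\kappa_y=L_y/\mu_y$, $\kappa_{xy}=L_{xy}/\sqrt{\mu_x\mu_y}$. Sim-GDA with constant step sizes $\alpha,\beta>0$: $x_{k+1}=x_k-\alpha\nabla_xf(x_k,y_k)$, $y_{k+1}=y_k+\beta\nabla_yf(x_k,y_k)$,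 from $(x_0,y_0)$; $z_k=(x_k,y_k)$. Lyapunov function: $\Psi^{\mathrm{Sim}}_k=\frac1\alpha\|x_k-x_\star\|^2+\frac1\beta\|y_k-y_\star\|^2$. Convention: $\log 0=-\infty$. *)

(* Defs.v *)
From HB Require Import structures.
From mathcomp Require Import all_boot all_order all_algebra.
From mathcomp Require Import all_classical all_reals all_analysis.
Set Implicit Arguments.
Unset Strict Implicit.
Unset Printing Implicit Defensive.
Import Order.TTheory GRing.Theory Num.Theory.
Import numFieldNormedType.Exports.
Local Open Scope ring_scope.

Section Euclidean.
Variable R : realType.

Definition dotv n (u v : 'rV[R]_n) : R := \sum_(i < n) u 0 i * v 0 i.

(* The library norm `|u| on 'rV[R]_n is the sup norm. It serves only for the
   (equivalent) topology behind [differentiable]; all the estimates use this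
   Euclidean norm. *)
Definition enorm n (u : 'rV[R]_n) : R := Num.sqrt (dotv u u).

Definition enorm2 m n (z : 'rV[R]_m * 'rV[R]_n) : R :=
  Num.sqrt (dotv z.1 z.1 + dotv z.2 z.2).

Definition grad n (g : 'rV[R]_n -> R) (x : 'rV[R]_n) : 'rV[R]_n :=
  \row_(i < n) 'D_(delta_mx 0 i) g x.

Definition strongly_convex n (mu : R) (g : 'rV[R]_n -> R) : Prop :=
  forall z z' : 'rV[R]_n,
    g z + dotv (grad g z) (z' - z) + mu / 2 * enorm (z' - z) ^+ 2 <= g z'.

Definition strongly_concave n (mu : R) (g : 'rV[R]_n -> R) : Prop :=
  strongly_convex mu (fun z => - g z).

End Euclidean.

Section Minimax.
Variables (R : realType) (dx dy : nat).
Implicit Types (f : 'rV[R]_dx * 'rV[R]_dy -> R) (z : 'rV[R]_dx * 'rV[R]_dy).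

Definition gradx f z : 'rV[R]_dx := grad (fun x => f (x, z.2)) z.1.
Definition grady f z : 'rV[R]_dy := grad (fun y => f (z.1, y)) z.2.

(* Frechet differentiability of f and of its full gradient; f need not be C^2. *)
Definition twice_differentiable f : Prop :=
  (forall z, differentiable f z) /\
  (forall z, differentiable (fun w => (gradx f w, grady f w)) z).

Record fclass (mux muy Lx Ly Lxy : R) f : Prop := FClass {
  fclass_diff2 : twice_differentiable f ;
  fclass_convex : forall y, strongly_convex mux (fun x => f (x, y)) ;
  fclass_concave : forall x, strongly_concave muy (fun y => f (x, y)) ;
  fclass_Lx : forall x x' y,
    enorm (gradx f (x', y) - gradx f (x, y)) <= Lx * enorm (x' - x) ;
  fclass_Ly : forall x y y',
    enorm (grady f (x, y') - grady f (x, y)) <= Ly * enorm (y' - y) ;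
  fclass_Lxy : forall x y y',
    enorm (gradx f (x, y') - gradx f (x, y)) <= Lxy * enorm (y' - y) ;
  fclass_Lyx : forall x x' y,
    enorm (grady f (x', y) - grady f (x, y)) <= Lxy * enorm (x' - x)
}.

Definition nash f z : Prop :=
  forall x y, f (z.1, y) <= f z /\ f z <= f (x, z.2).

Definition sim_gda_step f (alpha beta : R) z : 'rV[R]_dx * 'rV[R]_dy :=
  (z.1 - alpha *: gradx f z, z.2 + beta *: grady f z).

Definition sim_gda f (alpha beta : R) z0 (k : nat) : 'rV[R]_dx * 'rV[R]_dy :=
  iter k (sim_gda_step f alpha beta) z0.

Definition Psi_sim (alpha beta : R) (zstar z : 'rV[R]_dx * 'rV[R]_dy) : R :=
  alpha^-1 * enorm (z.1 - zstar.1) ^+ 2 + beta^-1 * enorm (z.2 - zstar.2) ^+ 2.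

End Minimax.

Section Constants.
Variable R : realType.
Implicit Types mu L kx ky kxy alpha beta : R.

Definition cond mu L : R := L / mu.

Definition cond_xy mux muy Lxy : R := Lxy / Num.sqrt (mux * muy).

Definition xi_sim kx ky kxy : R := kxy + Num.sqrt (Num.max kx ky + kxy ^+ 2).

Definition rate_sim kx ky kxy : R :=
  let xi := xi_sim kx ky kxy in ((xi ^+ 2 - 1) / (xi ^+ 2 + 1)) ^+ 2.

Definition A_sim alpha beta : R := Num.min alpha^-1 beta^-1.

End Constants.

(* Main.v *)
(** Put q(x, y) = |x|^2 / (2 alpha) - |y|^2 / (2 beta) - f(x, y). Up to the
    sign of the second block, one step of Sim-GDA is the gradient of q in the
    metric N(h, k) = |h|^2 / alpha + |k|^2 / beta, so it contracts by the factor
    rho as soon as q deviates from its first-order expansions by at most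
    rho / 2 N. These two-sided bounds on q follow blockwise from convexity in x,
    concavity in y and the cross-Lipschitz condition; no second derivative is
    needed. With eta = alpha mu_x = beta mu_y they reduce to the scalar
    condition (rho - 1 + eta) (rho + 1 - eta kappa) >= (eta kappa_xy)^2,
    kappa = max(kappa_x, kappa_y), whose smallest solution rho, attained at
    eta = 2 xi / (s (xi^2 + 1)) with s^2 = kappa + kappa_xy^2, is
    (xi^2 - 1) / (xi^2 + 1). *)
Require Import Defs.
From HB Require Import structures.
From mathcomp Require Import all_boot all_order all_algebra.
From mathcomp Require Import all_classical all_reals all_analysis.
From mathcomp Require Import ring lra.
Set Implicit Arguments.
Unset Strict Implicit.
Unset Printing Implicit Defensive.
Import Order.TTheory GRing.Theory Num.Theory.
Import numFieldNormedType.Exports.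
Local Open Scope ring_scope.

(** * Euclidean inner product and the Cauchy-Schwarz inequality *)

Section DotProduct.
Variables (R : realType) (n : nat).
Implicit Types (u v w : 'rV[R]_n) (a : R).

Lemma dotvC u v : dotv u v = dotv v u.
Proof. by apply: eq_bigr => i _; rewrite mulrC. Qed.

Lemma dotvDl u v w : dotv (u + v) w = dotv u w + dotv v w.
Proof. by rewrite /dotv -big_split; apply: eq_bigr => i _; rewrite mxE mulrDl. Qed.

Lemma dotvZl a u v : dotv (a *: u) v = a * dotv u v.
Proof. by rewrite /dotv mulr_sumr; apply: eq_bigr => i _; rewrite mxE mulrA. Qed.

Lemma dotvNl u v : dotv (- u) v = - dotv u v.
Proof. by rewrite -scaleN1r dotvZl mulN1r. Qed.

Lemma dotvDr u v w : dotv u (v + w) = dotv u v + dotv u w.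
Proof. by rewrite dotvC dotvDl !(dotvC _ u). Qed.

Lemma dotvZr a u v : dotv u (a *: v) = a * dotv u v.
Proof. by rewrite dotvC dotvZl dotvC. Qed.

Lemma dotvNr u v : dotv u (- v) = - dotv u v.
Proof. by rewrite dotvC dotvNl dotvC. Qed.

Definition dotvE := (dotvDl, dotvDr, dotvNl, dotvNr, dotvZl, dotvZr).

Lemma dotv_ge0 u : 0 <= dotv u u.
Proof. by apply: sumr_ge0 => i _; rewrite -expr2 sqr_ge0. Qed.

Lemma dotv_eq0 u : dotv u u = 0 -> u = 0.
Proof.
move=> u0; apply/rowP => i; rewrite mxE; apply/eqP; rewrite -sqrf_eq0 expr2.
by apply/eqP; apply: (psumr_eq0P _ u0) => // j _; rewrite -expr2 sqr_ge0.
Qed.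

Lemma enorm_ge0 u : 0 <= enorm u. Proof. exact: sqrtr_ge0. Qed.

Lemma enorm_sqr u : enorm u ^+ 2 = dotv u u.
Proof. by rewrite sqr_sqrtr // dotv_ge0. Qed.

Lemma enormN u : enorm (- u) = enorm u.
Proof. by rewrite /enorm !dotvE opprK. Qed.

Lemma enormZ a u : enorm (a *: u) = `|a| * enorm u.
Proof. by rewrite /enorm !dotvE mulrA -expr2 sqrtrM ?sqr_ge0 // sqrtr_sqr. Qed.

Lemma dotv_le_enorm u v : dotv u v <= enorm u * enorm v.
Proof.
have [v0|vN0] := eqVneq (dotv v v) 0.
  by rewrite (dotv_eq0 v0) -(scale0r 0) dotvZr mul0r mulr_ge0 ?enorm_ge0.
have v_gt0 : 0 < dotv v v by rewrite lt_neqAle eq_sym vN0 dotv_ge0.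
apply: le_trans (ler_norm _) _.
rewrite -ler_sqr ?nnegrE ?mulr_ge0 ?enorm_ge0 //.
rewrite exprMn !enorm_sqr real_normK ?num_real // -subr_ge0 -(pmulr_rge0 _ v_gt0).
(* The squared norm of this vector equals |v|^2 (|u|^2 |v|^2 - <u, v>^2), which is why the goal was
   multiplied by |v|^2. *)
have := dotv_ge0 (dotv v v *: u - dotv u v *: v).
by rewrite !dotvE (dotvC v u) => h; lra.
Qed.

End DotProduct.

(** * Passing between quadratic bounds on a function and Lipschitz bounds on its gradient *)

Section FirstOrderBounds.
Variable R : realType.

Lemma le_geometric_defect (x y c : R) :
  (forall k : nat, x <= y + c / 2 ^+ k) -> x <= y.
Proof.
move=> h; apply/ler_addgt0Pr => e e_gt0.
have [k hk] : exists k : nat, `|c| / e < k%:R.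
  by exists (Num.truncn (`|c| / e)).+1; apply: truncnS_gt.
have k2 : (k%:R : R) <= 2 ^+ k by rewrite -natrX ler_nat ltnW // ltn_expl.
apply: le_trans (h k) _; rewrite lerD2l ler_pdivrMr ?exprn_gt0 //.
apply: le_trans (ler_norm _) _; rewrite mulrC -ler_pdivrMr //.
exact: le_trans (ltW hk) k2.
Qed.

(* Bisecting [z, z'] turns the constant [c] into [c / 2 + L / 4], whose fixed
   point is [L / 2]; convexity provides the starting constant [L]. *)
Lemma convex_lipschitz_upper n (g : 'rV[R]_n -> R) (G : 'rV[R]_n -> 'rV[R]_n)
    (L : R) :
  (forall z h, g z + dotv (G z) h <= g (z + h)) ->
  (forall z h, enorm (G (z + h) - G z) <= L * enorm h) ->
  forall z h, g (z + h) <= g z + dotv (G z) h + L / 2 * enorm h ^+ 2.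
Proof.
move=> gC gL.
have cross z h k : dotv (G (z + h)) k <= dotv (G z) k + L * enorm h * enorm k.
  rewrite -lerBlDl -dotvNl -dotvDl; apply: le_trans (dotv_le_enorm _ _) _.
  by rewrite ler_wpM2r ?enorm_ge0.
have bisect k z h : g (z + h) <= g z + dotv (G z) h
    + (L / 2 + L / 2 / 2 ^+ k) * enorm h ^+ 2.
  elim: k z h => [|k IH] z h.
    have := gC (z + h) (- h); rewrite addrK dotvNr => h1.
    have := cross z h h; rewrite expr0; lra.
  have -> : z + h = (z + 2^-1 *: h) + 2^-1 *: h.
    by rewrite -addrA -scalerDl -[in LHS](scale1r h); congr (_ + _ *: _); field.
  have h1 := IH z (2^-1 *: h); have h2 := IH (z + 2^-1 *: h) (2^-1 *: h).
  have h3 := cross z (2^-1 *: h) (2^-1 *: h).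
  move: h1 h2 h3; rewrite !enormZ !dotvZr ger0_norm ?invr_ge0 // (exprS 2 k) invfM.
  by move: (2 ^+ k)^-1 => t; rewrite /=; lra.
move=> z h; apply: (@le_geometric_defect _ _ (L / 2 * enorm h ^+ 2)) => k.
by have := bisect k z h; lra.
Qed.

(* Comparing both quadratic bounds at the two points (z + w)/2 -+ e gives
   <G w - G z, 2 e> <= rho (N (w - z) / 2 + 2 N e); then [e] is taken along the
   gradient difference. *)
Lemma quadratic_bounds_lipschitz m n (q : 'rV[R]_m -> 'rV[R]_n -> R)
    (Gx : 'rV[R]_m -> 'rV[R]_n -> 'rV[R]_m)
    (Gy : 'rV[R]_m -> 'rV[R]_n -> 'rV[R]_n) (a b rho : R) :
  0 < a -> 0 < b -> 0 <= rho ->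
  (forall x y h k,
    `|q (x + h) (y + k) - q x y - dotv (Gx x y) h - dotv (Gy x y) k|
      <= rho / 2 * (a^-1 * dotv h h + b^-1 * dotv k k)) ->
  forall x y h k,
    a * enorm (Gx (x + h) (y + k) - Gx x y) ^+ 2
      + b * enorm (Gy (x + h) (y + k) - Gy x y) ^+ 2
      <= rho ^+ 2 * (a^-1 * dotv h h + b^-1 * dotv k k).
Proof.
move=> a0 b0 rho0 hq x y h k; rewrite !enorm_sqr.
set gx := _ - Gx x y; set gy := _ - Gy x y.
have key s : 2 * s * (a * dotv gx gx + b * dotv gy gy)
    <= rho * ((a^-1 * dotv h h + b^-1 * dotv k k) / 2
              + 2 * s ^+ 2 * (a * dotv gx gx + b * dotv gy gy)).
  set ex := (s * a) *: gx; set ey := (s * b) *: gy.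
  set mx := 2^-1 *: h - ex; set px := 2^-1 *: h + ex.
  set my := 2^-1 *: k - ey; set py := 2^-1 *: k + ey.
  have hx : h = mx + px.
    by rewrite /mx /px addrACA addNr addr0 -scalerDl -[LHS]scale1r; congr (_ *: _); field.
  have hy : k = my + py.
    by rewrite /my /py addrACA addNr addr0 -scalerDl -[LHS]scale1r; congr (_ *: _); field.
  have zmp (V : zmodType) (z m' p' : V) : z + (m' + p') - p' = z + m'.
    by rewrite addrA addrK.
  have zpm (V : zmodType) (z m' p' : V) : z + (m' + p') - m' = z + p'.
    by rewrite (addrC m') zmp.
  have wpx : (x + h) + - px = x + mx by rewrite hx zmp.
  have wpy : (y + k) + - py = y + my by rewrite hy zmp.
  have wmx : (x + h) + - mx = x + px by rewrite hx zpm.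
  have wmy : (y + k) + - my = y + py by rewrite hy zpm.
  (* With z = (x, y) and w = (x + h, y + k), each of z + m and z + p is expanded both from z and
     from w. Adding the four bounds cancels all values of q and leaves the gradient difference
     paired with p - m. *)
  have h1 := hq x y mx my; have h2 := hq (x + h) (y + k) (- px) (- py).
  have h3 := hq (x + h) (y + k) (- mx) (- my); have h4 := hq x y px py.
  move: h1 h2 h3 h4; rewrite wpx wpy wmx wmy !ler_norml.
  move=> /andP[h1 _] /andP[_ h2] /andP[h3 _] /andP[_ h4].
  have parallelogram d (e v : 'rV[R]_d) : dotv (2^-1 *: v - e) (2^-1 *: v - e)
      + dotv (2^-1 *: v + e) (2^-1 *: v + e) = dotv v v / 2 + 2 * dotv e e.
    by rewrite !dotvE (dotvC e v); field.
  have diff d (e v g : 'rV[R]_d) :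
      dotv g (2^-1 *: v + e) - dotv g (2^-1 *: v - e) = 2 * dotv g e.
    by rewrite !dotvE; ring.
  have nx : dotv mx mx + dotv px px = dotv h h / 2 + 2 * s ^+ 2 * a ^+ 2 * dotv gx gx.
    by rewrite parallelogram /ex dotvZl dotvZr; ring.
  have ny : dotv my my + dotv py py = dotv k k / 2 + 2 * s ^+ 2 * b ^+ 2 * dotv gy gy.
    by rewrite parallelogram /ey dotvZl dotvZr; ring.
  have ipx : dotv gx px - dotv gx mx = 2 * s * a * dotv gx gx.
    by rewrite diff /ex dotvZr; ring.
  have ipy : dotv gy py - dotv gy my = 2 * s * b * dotv gy gy.
    by rewrite diff /ey dotvZr; ring.
  have -> : (a^-1 * dotv h h + b^-1 * dotv k k) / 2
      + 2 * s ^+ 2 * (a * dotv gx gx + b * dotv gy gy)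
      = a^-1 * (dotv mx mx + dotv px px) + b^-1 * (dotv my my + dotv py py).
    by rewrite nx ny; field; rewrite !gt_eqF.
  have gxE v : dotv gx v = dotv (Gx (x + h) (y + k)) v - dotv (Gx x y) v.
    by rewrite dotvDl dotvNl.
  have gyE v : dotv gy v = dotv (Gy (x + h) (y + k)) v - dotv (Gy x y) v.
    by rewrite dotvDl dotvNl.
  move: h1 h2 h3 h4 ipx ipy; rewrite !(gxE px, gxE mx, gyE py, gyE my).
  rewrite !dotvNr !dotvNl !opprK; clearbody mx px my py gx gy.
  by move=> h1 h2 h3 h4 ipx ipy; lra.
move: key; set P := _ + _ :> R; set N := a^-1 * _ + _ => key.
have [rho_eq0|rhoN0] := eqVneq rho 0.
  by have := key 1; rewrite rho_eq0; lra.
have rho_gt0 : 0 < rho by rewrite lt_neqAle eq_sym rhoN0.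
(* This s maximises 2 s P - 2 rho s^2 P, the part of [key] that depends on s. *)
have := key (2 * rho)^-1; rewrite -(ler_pM2r rho_gt0).
have -> : 2 * (2 * rho)^-1 * P * rho = P by field.
have -> : rho * (N / 2 + 2 * (2 * rho)^-1 ^+ 2 * P) * rho = (rho ^+ 2 * N + P) / 2.
  by field.
lra.
Qed.

End FirstOrderBounds.

(** * The scalar condition on step size and contraction factor *)

Section Scalars.
Variable R : realType.
Implicit Types (A B C X Y k b : R).

(** By AM-GM, (A X^2 + B Y^2)^2 >= 4 A B X^2 Y^2 >= 4 C^2 X^2 Y^2. *)
Lemma quadratic_form_ge0 A B C X Y :
  0 <= A -> 0 <= B -> 0 <= C -> 0 <= X -> 0 <= Y -> C ^+ 2 <= A * B ->
  2 * C * X * Y <= A * X ^+ 2 + B * Y ^+ 2.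
Proof.
move=> A0 B0 C0 X0 Y0 CAB.
have A2 := sqr_ge0 X; have Y2 := sqr_ge0 Y.
rewrite -ler_sqr ?nnegrE ?addr_ge0 ?mulr_ge0 //.
have : 0 <= (A * B - C ^+ 2) * (X ^+ 2 * Y ^+ 2).
  by rewrite !mulr_ge0 // subr_ge0.
have := sqr_ge0 (A * X ^+ 2 - B * Y ^+ 2); lra.
Qed.

Section OptimalStep.
Variables (k b : R).
Hypotheses (k_ge1 : 1 <= k) (b_ge0 : 0 <= b).
Let s : R := Num.sqrt (k + b ^+ 2).
Let xi : R := b + s.
Let u : R := 2 / (xi ^+ 2 + 1).

Definition optimal_step : R := 2 * (b + Num.sqrt (k + b ^+ 2))
  / (Num.sqrt (k + b ^+ 2) * ((b + Num.sqrt (k + b ^+ 2)) ^+ 2 + 1)).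

Definition contraction : R :=
  ((b + Num.sqrt (k + b ^+ 2)) ^+ 2 - 1) / ((b + Num.sqrt (k + b ^+ 2)) ^+ 2 + 1).

Let s2 : s ^+ 2 = k + b ^+ 2.
Proof. by rewrite sqr_sqrtr // addr_ge0 ?sqr_ge0 // (le_trans ler01). Qed.

Let s_gt0 : 0 < s.
Proof. by rewrite sqrtr_gt0 ltr_wpDr ?sqr_ge0 // (lt_le_trans ltr01). Qed.

Let b_le_s : b <= s.
Proof.
rewrite -ler_sqr ?nnegrE // ?(ltW s_gt0) // s2 lerDr.
exact: le_trans ler01 k_ge1.
Qed.

Let xi_ge1 : 1 <= xi ^+ 2.
Proof.
have : s ^+ 2 <= xi ^+ 2 by rewrite ler_sqr ?nnegrE /xi ?addr_ge0 ?(ltW s_gt0) // lerDr.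
have := sqr_ge0 b; move: s2 k_ge1; lra.
Qed.

Let xi_gt0 : 0 < xi. Proof. by rewrite ltr_wpDl. Qed.
Let xi1_gt0 : 0 < xi ^+ 2 + 1. Proof. by move: xi_ge1; lra. Qed.
Let u_gt0 : 0 < u. Proof. by rewrite divr_gt0. Qed.

Lemma contraction_ge0 : 0 <= contraction.
Proof. by rewrite divr_ge0 ?subr_ge0 // ltW. Qed.

Let contractionE : contraction = 1 - u.
Proof. by rewrite /contraction /u -/s -/xi; field; rewrite gt_eqF. Qed.

Let stepE : optimal_step = u * (xi / s).
Proof. by rewrite /optimal_step /u -/s -/xi; field; rewrite !gt_eqF. Qed.

Lemma optimal_step_gt0 : 0 < optimal_step.
Proof. by rewrite stepE mulr_gt0 // divr_gt0. Qed.

(** Both sides equal u (xi / s - 1), because xi - s = b. *)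
Let factor1 : contraction - (1 - optimal_step) = u * (b / s).
Proof. by rewrite contractionE stepE /xi; field; rewrite gt_eqF. Qed.

(** The key relation is k = (s - b) (s + b) = (s - b) xi. Multiplied by [factor1] this gives (u xi b
    / s)^2, the square of [optimal_step * b]. *)
Let factor2 : contraction + 1 - optimal_step * k = u * (xi ^+ 2 * (b / s)).
Proof.
have -> : k = s ^+ 2 - b ^+ 2 by rewrite s2; ring.
have -> : contraction + 1 = u * xi ^+ 2.
  by rewrite /contraction /u -/s -/xi; field; rewrite gt_eqF.
by rewrite stepE /xi; field; rewrite gt_eqF.
Qed.

Lemma contraction_low : 0 <= contraction - (1 - optimal_step).
Proof. by rewrite factor1 mulr_ge0 ?divr_ge0 // ltW. Qed.

Lemma contraction_high k' : k' <= k -> 0 <= contraction + 1 - optimal_step * k'.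
Proof.
move=> kk; apply: (@le_trans _ _ (contraction + 1 - optimal_step * k)).
  by rewrite factor2 mulr_ge0 ?(ltW u_gt0) // mulr_ge0 ?sqr_ge0 // divr_ge0 // ltW.
by rewrite lerD2l lerN2 ler_wpM2l // ltW // optimal_step_gt0.
Qed.

(* Equality for [k' = k]: [optimal_step] minimises the largest singular value of
   [[1 - eta, - eta b], [eta b, 1 - eta k]], and [contraction] is its value. *)
Lemma contraction_coupling k' : k' <= k ->
  (optimal_step * b) ^+ 2
    <= (contraction - (1 - optimal_step)) * (contraction + 1 - optimal_step * k').
Proof.
move=> kk; apply: (@le_trans _ _ ((contraction - (1 - optimal_step))
    * (contraction + 1 - optimal_step * k))).
  rewrite factor1 factor2 stepE le_eqVlt; apply/orP; left; apply/eqP.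
  by field; rewrite gt_eqF.
apply: ler_wpM2l; first exact: contraction_low.
by rewrite lerD2l lerN2 ler_wpM2l // ltW // optimal_step_gt0.
Qed.

Let xi_le : xi <= 2 * s. Proof. by rewrite /xi; move: b_le_s; lra. Qed.

Let s_le_xi : s <= xi. Proof. by rewrite /xi; move: b_ge0; lra. Qed.

(** From xi^2 <= xi^2 + 1 <= 2 xi^2 the step lies between 1 / (s xi) and 2 / (s xi). Then s <= xi <=
    2 s and s^2 <= K <= 2 s^2 give the constants 1/2 and 4. *)
Lemma optimal_step_bounds K : k + b ^+ 2 <= K -> K <= 2 * (k + b ^+ 2) ->
  2^-1 / K <= optimal_step <= 4 / K.
Proof.
rewrite -s2 => sK Ks.
have s2_gt0 : 0 < s ^+ 2 by rewrite exprn_gt0.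
have K_gt0 : 0 < K by apply: lt_le_trans sK.
have sx : s * xi <= 2 * s ^+ 2.
  by rewrite expr2 mulrCA ler_pM2l.
have sx' : s ^+ 2 <= xi ^+ 2 by rewrite ler_sqr ?nnegrE // ltW.
have -> : optimal_step = 2 * xi / (s * (xi ^+ 2 + 1)) by [].
have den_gt0 : 0 < s * (xi ^+ 2 + 1) by rewrite mulr_gt0.
apply/andP; split.
  rewrite ler_pdivrMr // mulrAC ler_pdivlMr //.
  apply: (@le_trans _ _ (xi * s ^+ 2 * 2)); last first.
    by rewrite -mulrA (mulrC _ 2) mulrA (mulrC xi); apply: ler_wpM2l => //; rewrite mulr_ge0 // ltW.
  have : s * xi ^+ 2 <= xi * s ^+ 2 * 2.
    have -> : s * xi ^+ 2 = xi * (s * xi) by ring.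
    by rewrite -mulrA (mulrC _ 2) ler_pM2l.
  have : s * 1 <= s * xi ^+ 2 by rewrite ler_pM2l.
  lra.
rewrite ler_pdivrMr // mulrAC ler_pdivlMr //.
apply: (@le_trans _ _ (2 * xi * (2 * s ^+ 2))).
  by rewrite ler_pM2l ?mulr_gt0.
have : s * (s * xi) <= s * (xi ^+ 2) by rewrite ler_pM2l // expr2 ler_pM2r.
move: s_gt0; lra.
Qed.

(** Since 0 <= 1 - u <= 1, squaring only decreases 1 - u; and u >= 1 / xi^2 >= 1 / (4 s^2). *)
Lemma contraction_sqr_le K : k + b ^+ 2 <= K -> contraction ^+ 2 <= 1 - (4 * K)^-1.
Proof.
rewrite -s2 => sK.
have s2_gt0 : 0 < s ^+ 2 by rewrite exprn_gt0.
have K_gt0 : 0 < K by apply: lt_le_trans sK.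
have xs : xi ^+ 2 <= 4 * s ^+ 2.
  have -> : 4 * s ^+ 2 = (2 * s) ^+ 2 by ring.
  by rewrite ler_sqr ?nnegrE ?mulr_ge0 // ltW.
have uK : (4 * K)^-1 <= u.
  rewrite /u -div1r ler_pdivrMr ?mulr_gt0 // mulrAC ler_pdivlMr //.
  by move: xi_ge1; lra.
have := contraction_ge0; rewrite contractionE => c0.
have : (1 - u) * (1 - u) <= (1 - u) * 1.
  by apply: ler_wpM2l => //; move: u_gt0; lra.
by rewrite -expr2; lra.
Qed.

End OptimalStep.
End Scalars.

(** * First-order bounds for f and the contraction of one step *)

Section SaddleFunction.
Variables (R : realType) (dx dy : nat) (f : 'rV[R]_dx * 'rV[R]_dy -> R).
Variables (mux muy Lx Ly Lxy : R).
Hypothesis fF : fclass mux muy Lx Ly Lxy f.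
Hypotheses (mux_gt0 : 0 < mux) (muy_gt0 : 0 < muy).
Implicit Types (x h : 'rV[R]_dx) (y k : 'rV[R]_dy).

Lemma gradN_snd x y : grad (fun y => - f (x, y)) y = - grady f (x, y).
Proof.
apply/rowP => i; rewrite !mxE; apply: (@deriveN _ _ _ (fun y => f (x, y))).
(* The derivability needed to negate a partial derivative comes from the joint differentiability of
   f, in the direction (0, e_i). *)
pose e : 'rV[R]_dx * 'rV[R]_dy := (0, delta_mx 0 i).
have : derivable f (x, y) e := diff_derivable ((fclass_diff2 fF).1 (x, y)).
rewrite /derivable (_ : (fun t : R => _) = fun t : R =>
  t^-1 *: (((fun y => f (x, y)) \o shift y) (t *: delta_mx 0 i) - f (x, y))) //.
apply/funext => t /=; congr (_ *: (f _ - _)).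
by congr pair; rewrite /= scaler0 add0r.
Qed.

Lemma gradx_lower x y h :
  f (x, y) + dotv (gradx f (x, y)) h + mux / 2 * enorm h ^+ 2 <= f (x + h, y).
Proof. by have := fclass_convex fF y x (x + h); rewrite (addrC x) addrK. Qed.

Lemma grady_upper x y k :
  f (x, y + k) <= f (x, y) + dotv (grady f (x, y)) k - muy / 2 * enorm k ^+ 2.
Proof.
have := fclass_concave fF x y (y + k).
by rewrite gradN_snd dotvNl (addrC y) addrK => h; lra.
Qed.

Lemma gradx_upper x y h :
  f (x + h, y) <= f (x, y) + dotv (gradx f (x, y)) h + Lx / 2 * enorm h ^+ 2.
Proof.
apply: (convex_lipschitz_upper (g := fun x => f (x, y))
  (G := fun x => gradx f (x, y))) => {}x {}h.
  apply: le_trans (gradx_lower x y h); rewrite lerDl.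
  by rewrite mulr_ge0 ?sqr_ge0 // divr_ge0 // ltW.
by have := fclass_Lx fF x (x + h) y; rewrite [X in enorm X <= _]addrC (addrC x) addrK addrC.
Qed.

Lemma grady_lower x y k :
  f (x, y) + dotv (grady f (x, y)) k - Ly / 2 * enorm k ^+ 2 <= f (x, y + k).
Proof.
have := @convex_lipschitz_upper _ _ (fun y => - f (x, y)) (fun y => - grady f (x, y)) Ly.
move=> /(_ _ _ y k) h; have {h} := h _ _; rewrite dotvNl => h.
suff : - f (x, y + k) <= - f (x, y) - dotv (grady f (x, y)) k + Ly / 2 * enorm k ^+ 2 by lra.
apply: h => {}y {}k.
  have := grady_upper x y k; rewrite dotvNl.
  have : 0 <= muy / 2 * enorm k ^+ 2 by rewrite mulr_ge0 ?sqr_ge0 // divr_ge0 // ltW.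
  lra.
have := fclass_Ly fF x y (y + k).
by rewrite -opprD enormN (addrAC y) subrr add0r.
Qed.

Lemma gradx_cross x y k h :
  `|dotv (gradx f (x, y + k) - gradx f (x, y)) h| <= Lxy * enorm k * enorm h.
Proof.
have cross h' : dotv (gradx f (x, y + k) - gradx f (x, y)) h' <= Lxy * enorm k * enorm h'.
  apply: le_trans (dotv_le_enorm _ _) _; rewrite ler_wpM2r ?enorm_ge0 //.
  by have := fclass_Lxy fF x y (y + k); rewrite (addrAC y) subrr add0r.
by rewrite ler_norml cross andbT lerNl -dotvNr -(enormN h) cross.
Qed.

(** The path goes from (x, y) to (x, y + k), then to (x + h, y + k). The second leg uses the
    x-gradient at (x, y + k); moving it back to (x, y) costs at most Lxy |h| |k|. *)
Lemma saddle_expansion x y h k :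
  let D := f (x + h, y + k) - f (x, y) - dotv (gradx f (x, y)) h
           - dotv (grady f (x, y)) k in
  mux * enorm h ^+ 2 - Ly * enorm k ^+ 2 - 2 * Lxy * enorm h * enorm k <= 2 * D /\
  2 * D <= Lx * enorm h ^+ 2 - muy * enorm k ^+ 2 + 2 * Lxy * enorm h * enorm k.
Proof.
move=> /=; have := gradx_cross x y k h; rewrite dotvDl dotvNl ler_norml => /andP[].
have := gradx_lower x (y + k) h; have := gradx_upper x (y + k) h.
have := grady_lower x y k; have := grady_upper x y k.
by split; lra.
Qed.

(** Optimality and the quadratic model give 0 <= <g, v> + L/2 |v|^2 for all v; at v = - g / L the
    right side is - |g|^2 / (2 L). *)
Lemma nash_grad0 zstar : 0 < Lx -> 0 < Ly -> nash f zstar ->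
  gradx f zstar = 0 /\ grady f zstar = 0.
Proof.
have stationary d L (g : 'rV[R]_d) : 0 < L ->
    (forall v, 0 <= dotv g v + L / 2 * enorm v ^+ 2) -> g = 0.
  move=> L0 /(_ (- L^-1 *: g)); rewrite enorm_sqr !dotvE => h.
  apply: dotv_eq0; apply/eqP; rewrite eq_le dotv_ge0 andbT.
  have e : - L^-1 * dotv g g + L / 2 * (- L^-1 * (- L^-1 * dotv g g))
    = - (dotv g g / (2 * L)) by field; rewrite gt_eqF.
  by move: h; rewrite e oppr_ge0 pmulr_lle0 // invr_gt0 mulr_gt0.
case: zstar => x y Lx0 Ly0 fN; split.
  apply: (stationary _ Lx) => // h; have [_ /=] := fN (x + h) y.
  by have := gradx_upper x y h; lra.
apply/eqP; rewrite -oppr_eq0; apply/eqP; apply: (stationary _ Ly) => // k.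
have [/= + _] := fN x (y + k); have := grady_lower x y k; rewrite dotvNl; lra.
Qed.

(* The iterates of Sim-GDA are, up to the sign of the second block, the scaled
   gradients of q(x, y) = |x|^2 / (2 alpha) - |y|^2 / (2 beta) - f(x, y). *)
Lemma sim_gda_step_contracts (eta rho alpha beta : R) zstar z :
  alpha = eta / mux -> beta = eta / muy ->
  0 < eta -> 0 <= rho -> 0 <= Lxy -> 0 < Lx -> 0 < Ly ->
  (forall kappa, kappa = cond mux Lx \/ kappa = cond muy Ly ->
     [/\ 0 <= rho - (1 - eta), 0 <= rho + 1 - eta * kappa
       & (eta * cond_xy mux muy Lxy) ^+ 2
           <= (rho - (1 - eta)) * (rho + 1 - eta * kappa)]) ->
  nash f zstar ->
  Psi_sim alpha beta zstar (sim_gda_step f alpha beta z)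
    <= rho ^+ 2 * Psi_sim alpha beta zstar z.
Proof.
move=> alphaE betaE eta0 rho0 Lxy0 Lx0 Ly0 hk fN.
set b := cond_xy mux muy Lxy in hk.
have a0 : 0 < alpha by rewrite alphaE divr_gt0.
have b0 : 0 < beta by rewrite betaE divr_gt0.
have aE : alpha^-1 = mux / eta by rewrite alphaE invf_div.
have bE : beta^-1 = muy / eta by rewrite betaE invf_div.
have bsq : b ^+ 2 = Lxy ^+ 2 / (mux * muy).
  by rewrite /b /cond_xy expr_div_n sqr_sqrtr // ltW // mulr_gt0.
(* As 1 / alpha = mux / eta and 1 / beta = muy / eta, the instance (mux, muy, Ly) bounds the
   deviation of q from above and (muy, mux, Lx) bounds it from below. *)
have form m n L X Y : 0 < m -> 0 < n -> m * n = mux * muy ->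
    0 <= rho - (1 - eta) -> 0 <= rho + 1 - eta * (L / n) ->
    (eta * b) ^+ 2 <= (rho - (1 - eta)) * (rho + 1 - eta * (L / n)) ->
    0 <= X -> 0 <= Y ->
    2 * Lxy * X * Y <= ((rho - 1) * (m / eta) + m) * X ^+ 2
                       + ((rho + 1) * (n / eta) - L) * Y ^+ 2.
  move=> m0 n0 mn r1 r2 r3 X0 Y0.
  have e1 : (rho - 1) * (m / eta) + m = m / eta * (rho - (1 - eta)).
    by field; rewrite gt_eqF.
  have e2 : (rho + 1) * (n / eta) - L = n / eta * (rho + 1 - eta * (L / n)).
    by field; rewrite !gt_eqF.
  rewrite e1 e2; apply: quadratic_form_ge0 => //;
    rewrite ?mulr_ge0 ?invr_ge0 ?(ltW m0) ?(ltW n0) ?(ltW eta0) //.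
  have -> : Lxy ^+ 2 = (m * n / eta ^+ 2) * (eta * b) ^+ 2.
    by rewrite exprMn bsq mn; field; rewrite !gt_eqF.
  have -> : m / eta * (rho - (1 - eta)) * (n / eta * (rho + 1 - eta * (L / n)))
     = (m * n / eta ^+ 2) * ((rho - (1 - eta)) * (rho + 1 - eta * (L / n))).
    by field; rewrite !gt_eqF.
  by rewrite ler_pM2l // divr_gt0 ?mulr_gt0 ?exprn_gt0.
have [x1 x2 x3] := hk _ (or_introl erefl).
have [y1 y2 y3] := hk _ (or_intror erefl).
pose q x y := (alpha^-1 * dotv x x - beta^-1 * dotv y y) / 2 - f (x, y).
have := @quadratic_bounds_lipschitz _ _ _ q
  (fun x y => alpha^-1 *: x - gradx f (x, y))
  (fun x y => - (beta^-1 *: y) - grady f (x, y)) alpha beta rho a0 b0 rho0 _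
  zstar.1 zstar.2 (z.1 - zstar.1) (z.2 - zstar.2).
rewrite !(addrC _ (_ - _)) !subrK.
have [gx0 gy0] := nash_grad0 Lx0 Ly0 fN.
have -> : (zstar.1, zstar.2) = zstar by case: (zstar).
have -> : (z.1, z.2) = z by case: (z).
rewrite gx0 gy0 !subr0.
(* Since the gradients of f vanish at [zstar], the increments of the gradient of q are the scaled
   errors after one step. *)
have -> : alpha^-1 *: z.1 - gradx f z - alpha^-1 *: zstar.1
   = alpha^-1 *: ((sim_gda_step f alpha beta z).1 - zstar.1).
  by rewrite /= !scalerBr scalerA mulVf ?gt_eqF // scale1r.
have -> : - (beta^-1 *: z.2) - grady f z - - (beta^-1 *: zstar.2)
   = - (beta^-1 *: ((sim_gda_step f alpha beta z).2 - zstar.2)).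
  by rewrite /= scalerBr scalerDr scalerA mulVf ?gt_eqF // scale1r !opprD.
rewrite enormN !enormZ !exprMn !real_normK ?num_real // -!enorm_sqr.
have inv_sq (c d : R) : 0 < c -> c * (c^-1 ^+ 2 * d) = c^-1 * d.
  by move=> c0; field; rewrite gt_eqF.
rewrite !inv_sq // /Psi_sim; apply=> x y h k.
have := saddle_expansion x y h k.
have := form _ _ _ _ _ mux_gt0 muy_gt0 erefl y1 y2 y3 (enorm_ge0 h) (enorm_ge0 k).
have := form _ _ _ _ _ muy_gt0 mux_gt0 (mulrC _ _) x1 x2 x3 (enorm_ge0 k) (enorm_ge0 h).
rewrite /q aE bE !enorm_sqr ler_norml !dotvDl !dotvDr !dotvNl !dotvZl (dotvC h x) (dotvC k y).
move=> h1 h2 [h3 h4]; apply/andP; split; lra.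
Qed.

End SaddleFunction.

(** * From the contraction factor to the iteration count *)

Lemma Psi_sim_lower (R : realType) m n (alpha beta : R)
    (zstar z : 'rV[R]_m * 'rV[R]_n) :
  A_sim alpha beta * enorm2 (z - zstar) ^+ 2 <= Psi_sim alpha beta zstar z.
Proof.
rewrite /enorm2 sqr_sqrtr ?addr_ge0 ?dotv_ge0 // /Psi_sim !enorm_sqr mulrDr.
by rewrite lerD ?ler_wpM2r ?dotv_ge0 // /A_sim ge_min lexx ?orbT.
Qed.

(** From 1 - 1/T <= exp (- 1/T) one gets r^K <= exp (- K/T), and the hypothesis says P / t <= exp
    (K/T). For P = 0 the logarithm is -oo, so every K qualifies and the claim is 0 <= t. *)
Lemma linear_rate_complexity (R : realType) (r T P t : R) (K : nat) :
  0 <= r -> 0 < T -> r <= 1 - T^-1 -> 0 <= P -> 0 < t ->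
  (T%:E * lne (P / t)%:E <= (K%:R : R)%:E)%E -> r ^+ K * P <= t.
Proof.
move=> r0 T0 rT; rewrite le_eqVlt => /orP[/eqP <- t0 _|P0 t0].
  by rewrite mulr0 ltW.
rewrite lne_EFin ?divr_gt0 // -EFinM lee_fin => hK.
have rK : r ^+ K <= expR (- (K%:R / T)).
  rewrite -mulrN expRM_natl lerXn2r ?nnegrE ?expR_ge0 //.
  exact: le_trans rT (expR_ge1Dx _).
have Pt : P / t <= expR (K%:R / T).
  by rewrite -[P / t]lnK ?posrE ?divr_gt0 // ler_expR ler_pdivlMr // mulrC.
apply: le_trans (ler_wpM2r (ltW P0) rK) _.
by rewrite expRN ler_pdivrMl ?expR_gt0 // -ler_pdivrMr.
Qed.

(* The logarithm is the extended-real [lne], for which [lne 0 = -oo]. *)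
Theorem corollary3p2 (R : realType) :
  exists c1 c2 C : R,
    [/\ 0 < c1, c1 <= c2 & 0 < C] /\
    forall (mux muy Lx Ly Lxy : R),
      0 < mux -> mux <= Lx -> 0 < muy -> muy <= Ly -> 0 <= Lxy ->
    forall (dx dy : nat) (f : 'rV[R]_dx * 'rV[R]_dy -> R),
      fclass mux muy Lx Ly Lxy f ->
    let kx := cond mux Lx in
    let ky := cond muy Ly in
    let kxy := cond_xy mux muy Lxy in
    let kappa := kx + ky + kxy ^+ 2 in
    exists alpha beta : R,
      [/\ 0 < alpha, 0 < beta, alpha * mux = beta * muy
        & c1 / kappa <= alpha * mux <= c2 / kappa] /\
      forall zstar : 'rV[R]_dx * 'rV[R]_dy, nash f zstar ->
        (forall (z0 : 'rV[R]_dx * 'rV[R]_dy) (k : nat),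
           Psi_sim alpha beta zstar (sim_gda f alpha beta z0 k.+1)
           <= rate_sim kx ky kxy
              * Psi_sim alpha beta zstar (sim_gda f alpha beta z0 k)) /\
        (forall (z0 : 'rV[R]_dx * 'rV[R]_dy) (eps : R), 0 < eps ->
         forall K : nat,
           ((C * kappa)%:E
              * lne (Psi_sim alpha beta zstar z0 / (A_sim alpha beta * eps))%:E
            <= (K%:R : R)%:E)%E ->
           enorm2 (sim_gda f alpha beta z0 K - zstar) ^+ 2 <= eps).
Proof.
(* 1/2 and 4 come from [optimal_step_bounds]; C = 4 comes from [contraction_sqr_le], which gives r
   <= 1 - 1 / (4 kappa). *)
exists 2^-1, 4, 4; split; first by split; lra.
move=> mux muy Lx Ly Lxy mux0 muL muy0 muL' Lxy0 dx dy f fF kx ky kxy kappa.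
have kx1 : 1 <= kx by rewrite ler_pdivlMr // mul1r.
have ky1 : 1 <= ky by rewrite ler_pdivlMr // mul1r.
have kxy0 : 0 <= kxy by rewrite divr_ge0 // sqrtr_ge0.
set k := Num.max kx ky.
have kxk : kx <= k by rewrite le_max lexx.
have kyk : ky <= k by rewrite le_max lexx orbT.
have k1 : 1 <= k := le_trans kx1 kxk.
(* The maximum and the sum of kx and ky agree up to a factor 2, so kappa is comparable to k +
   kxy^2. *)
have kE : k <= kx + ky by rewrite ge_max; lra.
have kappa_ge : k + kxy ^+ 2 <= kappa by rewrite lerD2r.
have kappa_le : kappa <= 2 * (k + kxy ^+ 2).
  by have := sqr_ge0 kxy; rewrite /kappa; lra.
have kappa0 : 0 < kappa by have := sqr_ge0 kxy; rewrite /kappa; lra.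
set eta := optimal_step k kxy.
have eta0 : 0 < eta by exact: optimal_step_gt0.
have etaE mu : 0 < mu -> eta / mu * mu = eta by move=> mu0; rewrite mulfVK ?gt_eqF.
have [a0 b0] : 0 < eta / mux /\ 0 < eta / muy by split; apply: divr_gt0.
exists (eta / mux), (eta / muy); split.
  by split; rewrite ?etaE //; apply: optimal_step_bounds.
move=> zstar fN.
have step z0 n : Psi_sim (eta / mux) (eta / muy) zstar
      (sim_gda f (eta / mux) (eta / muy) z0 n.+1)
    <= rate_sim kx ky kxy * Psi_sim (eta / mux) (eta / muy) zstar
      (sim_gda f (eta / mux) (eta / muy) z0 n).
  apply: (sim_gda_step_contracts fF) => //.
  - exact: contraction_ge0.
  - exact: lt_le_trans muL.
  - exact: lt_le_trans muL'.
  move=> k' k'E; have k'k : k' <= k by case: k'E => ->; [exact: kxk|exact: kyk].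
  split; [exact: contraction_low|exact: contraction_high|].
  exact: contraction_coupling.
split=> // z0 eps eps0 K hK.
have A0 : 0 < A_sim (eta / mux) (eta / muy).
  by rewrite /A_sim lt_min !invr_gt0 a0 b0.
have r0 : 0 <= rate_sim kx ky kxy by rewrite sqr_ge0.
have P0 : 0 <= Psi_sim (eta / mux) (eta / muy) zstar z0.
  by apply: le_trans (Psi_sim_lower _ _ _ _); rewrite mulr_ge0 ?sqr_ge0 // ltW.
have decay : Psi_sim (eta / mux) (eta / muy) zstar
      (sim_gda f (eta / mux) (eta / muy) z0 K)
    <= rate_sim kx ky kxy ^+ K * Psi_sim (eta / mux) (eta / muy) zstar z0.
  elim: K {hK} => [|n IH]; first by rewrite mul1r.
  by apply: le_trans (step z0 n) _; rewrite exprS -mulrA ler_wpM2l.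
(* After scaling by A the chain is A |z_K - zstar|^2 <= Psi_K <= r^K Psi_0 <= A eps. *)
rewrite -(ler_pM2l A0); apply: le_trans (Psi_sim_lower _ _ _ _) _.
apply: le_trans decay _; apply: linear_rate_complexity hK => //.
- by rewrite mulr_gt0.
- exact: contraction_sqr_le.
- by rewrite mulr_gt0.
Qed.
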